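(* There exists a universal constant $c>0$ such that the following holds. Let $\tilde A\in\mathbb{R}^{n\times p}$, $\tilde Y\in\mathbb{R}^n$, $x^*\in\mathbb{R}_+^p$, $\gamma>2$, $\varepsilon>0$, $\kappa_1,\kappa_2>0$, and suppose that $$\|\tilde A x\|_2\ \ge\ \kappa_2\|x\|_2-\kappa_1\|x\|_1\qquad\text{for all }x\in\mathbb{R}^p .$$ (i) Let $d_1,\dots,d_p>0$ satisfy $|(\tilde A^\top(\tilde Y-\tilde A x^* ))_k|\le d_k$ for all $k=1,\dots,p$. Then for any set $S\subseteq\{1,\dots,p\}$ for which $$\|d_S\|_2\le d_{\min}\,\frac{\kappa_2-\varepsilon}{\kappa_1\rho_\gamma},$$ the weighted LASSO estimator $\hat x^{\rm WL}$ satisfies $$\|x^*-\hat x^{\rm WL}\|_2\le c\left(\frac{\rho_\gamma}{\varepsilon^2}\|d_S\|_2+\sqrt{\frac{\rho_\gamma}{\varepsilon^2}}\,\|Dx^*_{S^c}\|_1^{1/2}+\frac{\rho_\gamma\kappa_1}{\varepsilon\, d_{\min}}\|Dx^*_{S^c}\|_1\right).$$ (ii) Let $d>0$ satisfy $|(\tilde A^\top(\tilde Y-\tilde A x^* ))_k|\le d$ for all $k=1,\dots,p$. Then for any set $S\subseteq\{1,\dots,p\}$ with $s=|S|$ satisfying $$\sqrt{s}\le\frac{\kappa_2-\varepsilon}{\kappa_1\rho_\gamma},$$ the LASSO estimator $\hat x^{\rm LASSO}$ satisfies $$\|x^*-\hat x^{\rm LASSO}\|_2\le c\left(\frac{\rho_\gamma}{\varepsilon^2}\,d\sqrt{s}+\sqrt{\frac{\rho_\gamma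 d}{\varepsilon^2}}\,\|x^*_{S^c}\|_1^{1/2}+\frac{\rho_\gamma\kappa_1}{\varepsilon}\|x^*_{S^c}\|_1\right).$$
   Context: Notation: $\rho_\gamma:=\gamma\frac{\gamma+2}{\gamma-2}$; $d_{\min}:=\min_{1\le k\le p}d_k$; $D$ is the $p\times p$ diagonal matrix with $k$-th diagonal entry $d_k$; $\|d_S\|_2:=(\sum_{k\in S}d_k^2)^{1/2}$. For $z\in\mathbb{R}^p$ and $S\subseteq\{1,\dots,p\}$, $z_S\in\mathbb{R}^p$ has entries $(z_S)_i=z_i$ if $i\in S$ and $0$ otherwise; $S^c$ is the complement of $S$. The weighted LASSO estimator is any minimizer $$\hat x^{\rm WL}\in\arg\min_{x\in\mathbb{R}^p}\Big\{\|\tilde Y-\tilde Ax\|_2^2+\gamma\sum_{k=1}^p d_k|x_k|\Big\},$$ and the (classical) LASSO estimator is any minimizer $$\hat x^{\rm LASSO}\in\arg\min_{x\in\mathbb{R}^p}\big\{\|\tilde Y-\tilde Ax\|_2^2+\gamma d\|x\|_1\big\}.$$ *)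

(* Defs.v *)
From mathcomp Require Import all_boot all_order all_algebra.
From mathcomp Require Import reals.

Set Implicit Arguments.
Unset Strict Implicit.
Unset Printing Implicit Defensive.

Import Order.TTheory GRing.Theory Num.Theory.

Local Open Scope ring_scope.

Section Lasso.
Variable R : realType.

Definition rho (gamma : R) : R := gamma * ((gamma + 2) / (gamma - 2)).

(* The norm that MathComp-Analysis attaches to matrices is the sup norm, hence
   these definitions. *)
Definition l1norm (p : nat) (x : 'cV[R]_p) : R := \sum_(k < p) `|x k 0|.

Definition l2norm (p : nat) (x : 'cV[R]_p) : R :=
  Num.sqrt (\sum_(k < p) x k 0 ^+ 2).

Definition l2norm_on (p : nat) (S : {set 'I_p}) (d : 'cV[R]_p) : R :=
  Num.sqrt (\sum_(k in S) d k 0 ^+ 2).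

Definition restr (p : nat) (S : {set 'I_p}) (z : 'cV[R]_p) : 'cV[R]_p :=
  \col_(k < p) (if k \in S then z k 0 else 0).

(* Seeding the iterated minimum with the first entry, itself one of the terms,
   leaves it unchanged; a minimum only exists for vectors of positive size. *)
Definition vmin (p : nat) (d : 'cV[R]_p.+1) : R :=
  \big[Num.min/d ord0 0]_(k < p.+1) d k 0.

Definition minimizer (T : Type) (f : T -> R) (x : T) : Prop :=
  forall y : T, f x <= f y.

Definition weighted_lasso_obj (n p : nat) (A : 'M[R]_(n, p)) (Y : 'cV[R]_n)
    (gamma : R) (d : 'cV[R]_p) (x : 'cV[R]_p) : R :=
  l2norm (Y - A *m x) ^+ 2 + gamma * \sum_(k < p) d k 0 * `|x k 0|.

Definition lasso_obj (n p : nat) (A : 'M[R]_(n, p)) (Y : 'cV[R]_n)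
    (gamma d : R) (x : 'cV[R]_p) : R :=
  l2norm (Y - A *m x) ^+ 2 + gamma * d * l1norm x.

End Lasso.

(* Main.v *)
Require Import Defs.
From mathcomp Require Import all_boot all_order all_algebra.
From mathcomp Require Import reals.
From mathcomp Require Import ring lra.

Set Implicit Arguments.
Unset Strict Implicit.
Unset Printing Implicit Defensive.

Import Order.TTheory GRing.Theory Num.Theory.

Local Open Scope ring_scope.

(** With h := xhat - xs, write H_S and H_C for the sums of d_k |h_k| over S and
    over its complement, X for the sum of d_k |xs_k| over the complement of S,
    r for the Euclidean norm of h, m for the least weight and rho for rho gamma.
    Three facts carry the proof.

    - Comparing the objective at xhat and at xs, and using the bound d_k on the
      k-th coordinate of A^T (Y - A xs), gives
        |Ah|^2 + (gamma - 2) H_C <= (gamma + 2) H_S + 2 gamma X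
      ([weighted_lasso_basic_ineq]).
    - By Cauchy-Schwarz, H_S <= |d_S|_2 r ([l2norm_on_cauchy_schwarz]); as
      gamma > 2, the first fact then bounds H_C too, and hence the l1 norm of h,
      by a multiple of rho (|d_S|_2 r + X) / m.
    - Inserted into the restricted eigenvalue condition, this l1 bound costs at
      most (kappa2 - eps) r / 2 for its r part, by the condition on S, which
      also forces eps <= kappa2. What is left of the coefficient of r is
      (kappa2 + eps) / 2 >= eps, so |Ah| >= eps r - kappa1 rho X / (2 m).

    Either the error term kappa1 rho X / (2 m) is at least eps r / 2, and r is
    bounded by the last term of the claim, or |Ah| >= eps r / 2 and the first
    fact becomes a quadratic inequality in r, whose solution gives the first two
    terms ([error_radius_bound]). All constants fit into c = 8.

    The classical LASSO is the weighted one with all weights equal, so (ii) is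
    (i) for a constant vector of weights. *)

(** * Sums, norms and constant weights *)

Section Norms.
Variable R : realType.

(** Lagrange's identity: the gap F G - C^2 is half the double sum of the squares
    (f_i g_j - f_j g_i)^2. *)
Lemma sum_cauchy_schwarz (I : finType) (P : pred I) (f g : I -> R) :
  \sum_(i | P i) f i * g i <=
  Num.sqrt (\sum_(i | P i) f i ^+ 2) * Num.sqrt (\sum_(i | P i) g i ^+ 2).
Proof.
set F := \sum_(i | P i) f i ^+ 2; set G := \sum_(i | P i) g i ^+ 2.
set C := \sum_(i | P i) f i * g i.
have F0 : 0 <= F by apply: sumr_ge0 => i _; exact: sqr_ge0.
have lagrange : \sum_(i | P i) \sum_(j | P j) (f i * g j - f j * g i) ^+ 2
              = 2 * (F * G - C ^+ 2).
  under eq_bigr => i _.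
    under eq_bigr => j _.
      rewrite (_ : _ ^+ 2 = f i ^+ 2 * g j ^+ 2 + g i ^+ 2 * f j ^+ 2
                 - 2 * (f i * g i) * (f j * g j)); last by ring.
      over.
    rewrite sumrB big_split /= -!mulr_sumr.
    over.
  rewrite sumrB big_split /= -!mulr_suml -mulr_sumr -/F -/G -/C.
  by ring.
have : 0 <= 2 * (F * G - C ^+ 2).
  rewrite -lagrange; apply: sumr_ge0 => i _; apply: sumr_ge0 => j _.
  exact: sqr_ge0.
rewrite pmulr_rge0 // subr_ge0 => CFG.
rewrite -sqrtrM //; apply: le_trans (ler_norm C) _.
by rewrite -sqrtr_sqr ler_wsqrtr.
Qed.

Lemma sum_split_setC p (S : {set 'I_p}) (F : 'I_p -> R) :
  \sum_k F k = \sum_(k in S) F k + \sum_(k in ~: S) F k.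
Proof.
rewrite (bigID (mem S)) /=; congr (_ + _).
by apply: eq_bigl => k; rewrite inE.
Qed.

Lemma l2norm_ge0 p (x : 'cV[R]_p) : 0 <= l2norm x.
Proof. exact: sqrtr_ge0. Qed.

Lemma sqr_l2norm p (x : 'cV[R]_p) : l2norm x ^+ 2 = \sum_(k < p) x k 0 ^+ 2.
Proof. by rewrite sqr_sqrtr //; apply: sumr_ge0 => k _; exact: sqr_ge0. Qed.

Lemma l2normB p (x y : 'cV[R]_p) : l2norm (x - y) = l2norm (y - x).
Proof. by congr Num.sqrt; apply: eq_bigr => k _; rewrite !mxE; ring. Qed.

Lemma l2norm_on_cauchy_schwarz p (S : {set 'I_p}) (d h : 'cV[R]_p) :
  \sum_(k in S) d k 0 * `|h k 0| <= l2norm_on S d * l2norm h.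
Proof.
apply: le_trans (sum_cauchy_schwarz _ _ _) _.
apply: ler_wpM2l; first exact: sqrtr_ge0.
apply: ler_wsqrtr; under eq_bigr do rewrite real_normK ?num_real //.
rewrite [leRHS](bigID (mem S)) /= lerDl; apply: sumr_ge0 => k _.
exact: sqr_ge0.
Qed.

Lemma sqr_l2norm_residual n p (A : 'M[R]_(n, p)) (Y : 'cV[R]_n)
    (x h : 'cV[R]_p) :
  l2norm (Y - A *m (x + h)) ^+ 2 =
  l2norm (Y - A *m x) ^+ 2
  - 2 * \sum_(k < p) (A^T *m (Y - A *m x)) k 0 * h k 0
  + l2norm (A *m h) ^+ 2.
Proof.
have -> : Y - A *m (x + h) = (Y - A *m x) - A *m h.
  by rewrite mulmxDr opprD addrA.
move: (Y - A *m x) => v.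
have -> : \sum_(k < p) (A^T *m v) k 0 * h k 0
        = \sum_(i < n) v i 0 * (A *m h) i 0.
  transitivity (((A^T *m v)^T *m h) 0 0).
    by rewrite [RHS]mxE; apply: eq_bigr => k _; rewrite [_^T _ _]mxE.
  rewrite trmx_mul trmxK -mulmxA [LHS]mxE.
  by apply: eq_bigr => i _; rewrite [_^T _ _]mxE.
move: (A *m h) => w; rewrite !sqr_l2norm mulr_sumr -sumrB -big_split /=.
by apply: eq_bigr => i _; rewrite 2![in LHS]mxE; ring.
Qed.

Lemma vmin_le p (d : 'cV[R]_p.+1) k : vmin d <= d k 0.
Proof. exact: bigmin_le_cond. Qed.

Lemma vmin_gt0 p (d : 'cV[R]_p.+1) : (forall k, 0 < d k 0) -> 0 < vmin d.
Proof.
by move=> d0; rewrite /vmin; elim/big_ind: _ => // x y; rewrite lt_min => -> ->.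
Qed.

Lemma vmin_const p (a : R) : vmin (const_mx a : 'cV[R]_p.+1) = a.
Proof.
by rewrite /vmin; elim/big_ind: _ => [|x y -> ->|k _]; rewrite ?mxE // minxx.
Qed.

Lemma l2norm_on_const p (S : {set 'I_p}) (a : R) : 0 <= a ->
  l2norm_on S (const_mx a) = a * Num.sqrt #|S|%:R.
Proof.
move=> a0; rewrite /l2norm_on; under eq_bigr do rewrite mxE.
rewrite sumr_const -[a ^+ 2 *+ _]mulr_natr sqrtrM ?sqr_ge0 //.
by rewrite sqrtr_sqr ger0_norm.
Qed.

Lemma l1norm_diag_restr p (S : {set 'I_p}) (d x : 'cV[R]_p) :
  (forall k, 0 <= d k 0) ->
  l1norm (diag_mx d^T *m restr S x) = \sum_(k in S) d k 0 * `|x k 0|.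
Proof.
move=> d0; rewrite /l1norm [RHS]big_mkcond /=; apply: eq_bigr => k _.
rewrite mul_diag_mx !mxE normrM ger0_norm //.
by case: ifP; rewrite // normr0 mulr0.
Qed.

Lemma l1norm_restr p (S : {set 'I_p}) (x : 'cV[R]_p) :
  l1norm (restr S x) = \sum_(k in S) `|x k 0|.
Proof.
rewrite /l1norm [RHS]big_mkcond /=; apply: eq_bigr => k _.
by rewrite mxE; case: ifP; rewrite // normr0.
Qed.

End Norms.

(** * The error bound *)

Section ErrorBound.
Variable R : realType.

(** Expanding the square at x + h leaves |Ah|^2 and the cross term
    2 <A^T (Y - A x), h>, which the weights bound by 2 sum_k d_k |h_k|. The
    penalty difference is estimated by |x_k| - |x_k + h_k| <= |h_k| on S, and by
    |x_k| - |x_k + h_k| <= 2 |x_k| - |h_k| off S; the latter produces the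
    negative multiple of the off-support mass of h that makes the LASSO error
    concentrate on S. *)
Lemma weighted_lasso_basic_ineq n p (A : 'M[R]_(n, p)) (Y : 'cV[R]_n)
    (x h d : 'cV[R]_p) (gamma : R) (S : {set 'I_p}) :
  0 <= gamma -> (forall k, 0 <= d k 0) ->
  (forall k, `|(A^T *m (Y - A *m x)) k 0| <= d k 0) ->
  weighted_lasso_obj A Y gamma d (x + h) <= weighted_lasso_obj A Y gamma d x ->
  l2norm (A *m h) ^+ 2 + (gamma - 2) * \sum_(k in ~: S) d k 0 * `|h k 0| <=
  (gamma + 2) * (\sum_(k in S) d k 0 * `|h k 0|)
  + 2 * gamma * \sum_(k in ~: S) d k 0 * `|x k 0|.
Proof.
move=> g0 d0 noise; rewrite /weighted_lasso_obj sqr_l2norm_residual.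
set v := A^T *m _; set N := l2norm (A *m h) ^+ 2 => opt.
have corr : \sum_k v k 0 * h k 0 <= \sum_k d k 0 * `|h k 0|.
  apply: ler_sum => k _; apply: le_trans (ler_norm _) _.
  by rewrite normrM ler_wpM2r.
have onS : \sum_(k in S) d k 0 * `|x k 0| <=
    \sum_(k in S) d k 0 * `|(x + h) k 0| + \sum_(k in S) d k 0 * `|h k 0|.
  rewrite -big_split /=; apply: ler_sum => k _.
  rewrite -mulrDr ler_wpM2l // mxE.
  by have := ler_normB (x k 0 + h k 0) (h k 0); rewrite addrK.
have offS : \sum_(k in ~: S) d k 0 * `|h k 0| <=
    \sum_(k in ~: S) d k 0 * `|(x + h) k 0|
    + \sum_(k in ~: S) d k 0 * `|x k 0|.
  rewrite -big_split /=; apply: ler_sum => k _.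
  rewrite -mulrDr ler_wpM2l // mxE.
  by have := ler_normB (x k 0 + h k 0) (x k 0); rewrite addrAC subrr add0r.
move: opt corr; rewrite !(sum_split_setC S (fun k => d k 0 * _)).
move: onS offS.
set HS := \sum_(k in S) d k 0 * `|h k 0|.
set HC := \sum_(k in ~: S) d k 0 * `|h k 0|.
set XS := \sum_(k in S) d k 0 * `|x k 0|.
set XC := \sum_(k in ~: S) d k 0 * `|x k 0|.
set ZS := \sum_(k in S) d k 0 * `|(x + h) k 0|.
set ZC := \sum_(k in ~: S) d k 0 * `|(x + h) k 0|.
move=> onS offS opt corr.
have := ler_wpM2l g0 onS; have := ler_wpM2l g0 offS.
by lra.
Qed.

(** If r exceeded 8 (u + v), then r^2 would exceed 8 u r + 8 v r, where
    v r >= 8 v^2. *)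
Lemma le_of_quadratic_ineq (r u v : R) : 0 <= u -> 0 <= v ->
  r ^+ 2 <= 4 * u * r + 8 * v ^+ 2 -> r <= 8 * (u + v).
Proof.
move=> u0 v0 quad; rewrite leNgt; apply/negP => big.
have r0 : 0 < r by lra.
have : 8 * (u + v) * r < r ^+ 2 by rewrite expr2 ltr_pM2r.
have : 0 <= u * r by rewrite mulr_ge0 // ltW.
have : v * (8 * v) <= v * r by rewrite ler_wpM2l //; lra.
by nra.
Qed.

(** The scalar part of the argument. In the application a is |d_S|_2, X the
    weighted l1 mass of xs off S, m the least weight, r and l1 the l2 and l1
    norms of the error h, N the norm of A h, and HS, HC the weighted l1 masses
    of h on and off S. *)
Lemma error_radius_bound (gamma eps kappa1 kappa2 a X m r N l1 HS HC : R) :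
  2 < gamma -> 0 < eps -> 0 < kappa1 -> 0 < m ->
  0 <= a -> 0 <= X -> 0 <= r -> 0 <= N ->
  a <= m * ((kappa2 - eps) / (kappa1 * rho gamma)) ->
  kappa2 * r - kappa1 * l1 <= N ->
  m * l1 <= HS + HC -> HS <= a * r -> 0 <= HC ->
  N ^+ 2 + (gamma - 2) * HC <= (gamma + 2) * HS + 2 * gamma * X ->
  r <= 8 * (rho gamma / eps ^+ 2 * a
            + Num.sqrt (rho gamma / eps ^+ 2) * Num.sqrt X
            + rho gamma * kappa1 / (eps * m) * X).
Proof.
move=> g2 e0 k10 m0 a0 X0 r0 N0 sparse re l1H HSr HC0 basic.
set rh := rho gamma in sparse *.
have gm : 0 < gamma - 2 by lra.
have rhE : rh * (gamma - 2) = gamma * (gamma + 2).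
  by rewrite /rh /rho; field; rewrite gt_eqF.
(* A transparent body would let the rewriting lemmas on products unfold rh. *)
clearbody rh.
have rh0 : 0 < rh by rewrite -(pmulr_lgt0 _ gm) rhE mulr_gt0 //; lra.
have g_le_rh : gamma + 2 <= rh.
  by rewrite -(ler_pM2r gm) rhE mulrC ler_pM2r; lra.
set u := rh / eps ^+ 2 * a; set v := Num.sqrt _ * _; set w := _ * X.
have u0 : 0 <= u by rewrite mulr_ge0 // divr_ge0 ?sqr_ge0 // ltW.
have v0 : 0 <= v by rewrite mulr_ge0 ?sqrtr_ge0.
have w0 : 0 <= w.
  by rewrite mulr_ge0 // divr_ge0 // mulr_ge0 // ltW.
(* (gamma - 2) (HS + HC) <= 2 gamma (HS + X), and 2 gamma / (gamma - 2) is at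
   most rh / 2 because gamma + 2 >= 4. *)
have cone : m * l1 <= rh / 2 * (a * r + X).
  rewrite -(ler_pM2r gm).
  have : rh / 2 * (a * r + X) * (gamma - 2)
         = gamma * (gamma + 2) / 2 * (a * r + X) by rewrite -rhE; ring.
  move=> ->.
  have : (gamma - 2) * (m * l1) <= (gamma - 2) * (HS + HC).
    by rewrite ler_pM2l.
  have : gamma * HS <= gamma * (a * r) by rewrite ler_pM2l //; lra.
  have : 0 <= gamma * ((gamma - 2) * (a * r + X)).
    apply: mulr_ge0; first by lra.
    apply: mulr_ge0; first exact: ltW.
    by rewrite addr_ge0 // mulr_ge0.
  by move: (sqr_ge0 N) basic; lra.
have ak : kappa1 * rh * a <= m * (kappa2 - eps).
  have := ler_wpM2l (ltW (mulr_gt0 k10 rh0)) sparse.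
  rewrite (_ : _ * (m * _) = m * (kappa2 - eps)) //.
  by field; rewrite !gt_eqF.
have lower : m * eps * r - kappa1 * rh * X / 2 <= m * N.
  have : m * (kappa2 * r - kappa1 * l1) <= m * N by rewrite ler_pM2l.
  have : kappa1 * (m * l1) <= kappa1 * (rh / 2 * (a * r + X)).
    by rewrite ler_pM2l.
  have : kappa1 * rh * a * r <= m * (kappa2 - eps) * r by rewrite ler_wpM2r.
  have : 0 <= kappa1 * rh * a * r by rewrite !mulr_ge0 // ltW.
  by lra.
have wE : w * (m * eps) = rh * kappa1 * X.
  by rewrite /w; field; rewrite !gt_eqF.
(* If r <= w the last term of the bound suffices; otherwise the loss
   kappa1 rh X / 2 in the lower bound for m N is at most half of m eps r. *)
have [rw|wr] := leP r w; first by lra.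
have NE : eps * r / 2 <= N.
  rewrite -(ler_pM2l m0).
  have : w * (m * eps) <= r * (m * eps).
    by rewrite ler_wpM2r ?(ltW wr) // mulr_ge0 // ltW.
  by rewrite wE; lra.
have N2 : (eps * r / 2) ^+ 2 <= N ^+ 2.
  by rewrite ler_sqr ?nnegrE // divr_ge0 // mulr_ge0 // ltW.
suff : r <= 8 * (u + v) by lra.
apply: le_of_quadratic_ineq => //.
have e20 : 0 < eps ^+ 2 by rewrite exprn_gt0.
have v2 : v ^+ 2 * eps ^+ 2 = rh * X.
  rewrite /v exprMn !sqr_sqrtr // ?divr_ge0 ?ltW //.
  by field; rewrite gt_eqF.
have uE : u * eps ^+ 2 = rh * a by rewrite /u; field; rewrite gt_eqF.
rewrite -(ler_pM2r e20) mulrDl -(mulrA 8) v2.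
have -> : 4 * u * r * eps ^+ 2 = 4 * (u * eps ^+ 2) * r by ring.
rewrite uE.
have : (gamma + 2) * HS <= rh * (a * r).
  apply: le_trans (ler_wpM2l _ HSr) _; first by lra.
  by rewrite ler_wpM2r // mulr_ge0.
(* As gamma <= rh, the term 2 gamma X contributes at most 2 rh X; multiplied by
   the 4 that comes from (eps r / 2)^2, this is the 8 in front of v^2. *)
have : gamma * X <= rh * X by rewrite ler_wpM2r //; lra.
have : 0 <= (gamma - 2) * HC by rewrite mulr_ge0 // ltW.
by move: N2 basic; rewrite !exprMn exprVn; lra.
Qed.

Lemma weighted_lasso_error_bound n p (A : 'M[R]_(n, p.+1)) (Y : 'cV[R]_n)
    (xs : 'cV[R]_p.+1) (gamma eps kappa1 kappa2 : R) (d : 'cV[R]_p.+1)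
    (S : {set 'I_p.+1}) (xhat : 'cV[R]_p.+1) :
  2 < gamma -> 0 < eps -> 0 < kappa1 ->
  (forall x : 'cV[R]_p.+1,
     kappa2 * l2norm x - kappa1 * l1norm x <= l2norm (A *m x)) ->
  (forall k, 0 < d k 0) ->
  (forall k, `|(A^T *m (Y - A *m xs)) k 0| <= d k 0) ->
  l2norm_on S d <= vmin d * ((kappa2 - eps) / (kappa1 * rho gamma)) ->
  minimizer (weighted_lasso_obj A Y gamma d) xhat ->
  l2norm (xs - xhat) <=
    8 * (rho gamma / eps ^+ 2 * l2norm_on S d
         + Num.sqrt (rho gamma / eps ^+ 2)
           * Num.sqrt (l1norm (diag_mx d^T *m restr (~: S) xs))
         + rho gamma * kappa1 / (eps * vmin d)
           * l1norm (diag_mx d^T *m restr (~: S) xs)).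
Proof.
move=> g2 e0 k10 re d0 noise sparse opt.
have g0 : 0 <= gamma by lra.
have d0' k : 0 <= d k 0 by exact: ltW.
rewrite l2normB; set h := xhat - xs.
have xhatE : xhat = xs + h by rewrite addrC subrK.
have := opt xs; rewrite xhatE.
move/(weighted_lasso_basic_ineq S g0 d0' noise).
rewrite l1norm_diag_restr //.
apply: (@error_radius_bound _ _ _ kappa2 _ _ _ _ _ (l1norm h)) => //.
- exact: vmin_gt0.
- exact: sqrtr_ge0.
- by apply: sumr_ge0 => k _; rewrite mulr_ge0.
- exact: l2norm_ge0.
- exact: l2norm_ge0.
- rewrite -(sum_split_setC S (fun k => d k 0 * `|h k 0|)) /l1norm.
  rewrite mulr_sumr; apply: ler_sum => k _.
  by rewrite ler_wpM2r // vmin_le.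
- exact: l2norm_on_cauchy_schwarz.
- by apply: sumr_ge0 => k _; rewrite mulr_ge0.
Qed.

Lemma lasso_objE n p (A : 'M[R]_(n, p)) Y gamma a x :
  lasso_obj A Y gamma a x = weighted_lasso_obj A Y gamma (const_mx a) x.
Proof.
rewrite /lasso_obj /weighted_lasso_obj -mulrA /l1norm mulr_sumr.
by under [in RHS]eq_bigr do rewrite mxE.
Qed.

End ErrorBound.

Theorem proposition1 (R : realType) :
  exists c : R, 0 < c /\
  forall (n p : nat) (A : 'M[R]_(n, p.+1)) (Y : 'cV[R]_n) (xs : 'cV[R]_p.+1)
    (gamma eps kappa1 kappa2 : R),
    (forall k : 'I_p.+1, 0 <= xs k 0) ->
    2 < gamma -> 0 < eps -> 0 < kappa1 -> 0 < kappa2 ->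
    (forall x : 'cV[R]_p.+1,
       kappa2 * l2norm x - kappa1 * l1norm x <= l2norm (A *m x)) ->
    (forall d : 'cV[R]_p.+1,
       (forall k : 'I_p.+1, 0 < d k 0) ->
       (forall k : 'I_p.+1, `|(A^T *m (Y - A *m xs)) k 0| <= d k 0) ->
       forall S : {set 'I_p.+1},
       l2norm_on S d <= vmin d * ((kappa2 - eps) / (kappa1 * rho gamma)) ->
       forall xhat : 'cV[R]_p.+1,
       minimizer (weighted_lasso_obj A Y gamma d) xhat ->
       l2norm (xs - xhat) <=
         c * (rho gamma / eps ^+ 2 * l2norm_on S d
              + Num.sqrt (rho gamma / eps ^+ 2)
                * Num.sqrt (l1norm (diag_mx d^T *m restr (~: S) xs))
              + rho gamma * kappa1 / (eps * vmin d)
                * l1norm (diag_mx d^T *m restr (~: S) xs)))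
    /\
    (forall d : R,
       0 < d ->
       (forall k : 'I_p.+1, `|(A^T *m (Y - A *m xs)) k 0| <= d) ->
       forall S : {set 'I_p.+1},
       Num.sqrt (#|S|%:R) <= (kappa2 - eps) / (kappa1 * rho gamma) ->
       forall xhat : 'cV[R]_p.+1,
       minimizer (lasso_obj A Y gamma d) xhat ->
       l2norm (xs - xhat) <=
         c * (rho gamma / eps ^+ 2 * (d * Num.sqrt (#|S|%:R))
              + Num.sqrt (rho gamma * d / eps ^+ 2)
                * Num.sqrt (l1norm (restr (~: S) xs))
              + rho gamma * kappa1 / eps * l1norm (restr (~: S) xs))).
Proof.
exists 8; split=> // n p A Y xs gamma eps kappa1 kappa2 _ g2 e0 k10 _ re.
split=> [d d0 noise S sparse xhat|d d0 noise S sparse xhat opt].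
  exact: (weighted_lasso_error_bound g2 e0 k10 re).
have dd0 (k : 'I_p.+1) : 0 < (const_mx d : 'cV[R]_p.+1) k 0 by rewrite mxE.
have dn (k : 'I_p.+1) :
    `|(A^T *m (Y - A *m xs)) k 0| <= (const_mx d : 'cV[R]_p.+1) k 0.
  by rewrite [leRHS]mxE.
have opt' : minimizer (weighted_lasso_obj A Y gamma (const_mx d)) xhat.
  by move=> x; rewrite -!lasso_objE; exact: opt.
have sparse' : l2norm_on S (const_mx d) <=
    vmin (const_mx d : 'cV[R]_p.+1)
    * ((kappa2 - eps) / (kappa1 * rho gamma)).
  by rewrite vmin_const l2norm_on_const ?ler_pM2l // ltW.
have := weighted_lasso_error_bound g2 e0 k10 re dd0 dn sparse' opt'.
rewrite l1norm_diag_restr => [|k]; last exact: ltW.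
under eq_bigr do rewrite mxE.
rewrite -mulr_sumr -l1norm_restr vmin_const (l2norm_on_const _ (ltW d0)).
move: (l1norm _) => X.
have rh0 : 0 <= rho gamma by rewrite /rho mulr_ge0 ?divr_ge0 //; lra.
have -> : Num.sqrt (rho gamma / eps ^+ 2) * Num.sqrt (d * X)
        = Num.sqrt (rho gamma * d / eps ^+ 2) * Num.sqrt X.
  rewrite (sqrtrM _ (ltW d0)) mulrA -sqrtrM ?divr_ge0 ?sqr_ge0 //.
  by rewrite mulrAC.
have -> // : rho gamma * kappa1 / (eps * d) * (d * X)
           = rho gamma * kappa1 / eps * X.
by field; rewrite !gt_eqF.
Qed.
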